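(* Let $K=\mathbb{F}_q$ be a finite field, let $\mathbb{X}\subset\mathbb{P}^{s-1}$ be a nonempty set of points of the projective space over $K$, and let $k\geq 1$ and $d\geq 1$ be integers. Let $\rho_k\colon\mathbb{P}^{s-1}\to\mathbb{P}^{N-1}$, $N=\binom{k+s-1}{s-1}$, be the $k$-th Veronese embedding. Then the projective Reed--Muller-type codes $C_{\rho_k(\mathbb{X})}(d)$ and $C_{\mathbb{X}}(kd)$ have the same basic parameters (length, dimension, and minimum distance) and the same generalized Hamming weights, i.e. $\delta_r(C_{\rho_k(\mathbb{X})}(d))=\delta_r(C_{\mathbb{X}}(kd))$ for all $1\leq r\leq\dim_K C_{\mathbb{X}}(kd)$.
   Context: Let $K=\mathbb{F}_q$ and let $\mathbb{P}^{s-1}$ be the projective space over $K$ (points $[x]$, $x\in K^s\setminus\{0\}$, modulo scaling by $K^*$). A linear code of length $m$ is a $K$-linear subspace $C\subset K^m$. The support of a subspace $D\subset C$ is $\chi(D)=\{i : \exists (a_1,\ldots,a_m)\in D,\ a_i\neq 0\}$. For $1\leq r\leq\dim_K C$, the $r$-th generalized Hamming weight $\delta_r(C)$ is the minimum of $|\chi(D)|$ over all $r$-dimensional subspaces $D\subset C$; $\delta_1(C)$ is the minimum distance. Reed--Muller-type codes: for any $n\geq 1$, a nonempty set $\mathbb{Y}=\{[P_1],\ldots,[P_m]\}\subset\mathbb{P}^{n-1}$ with $m=|\mathbb{Y}|$, $P_i\in K^n$, and $e\geq 1$, choose for each $i$ a homogeneous polynomial $h_i\in K[t_1,\ldots,t_n]_e$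 of degree $e$ with $h_i(P_i)\neq 0$. Then $$C_{\mathbb{Y}}(e)=\left\{\left(\tfrac{h(P_1)}{h_1(P_1)},\ldots,\tfrac{h(P_m)}{h_m(P_m)}\right) : h\in K[t_1,\ldots,t_n]_e\right\}\subset K^m.$$ Its length, dimension, and generalized Hamming weights do not depend on the choices of the representatives $P_i$ and of the $h_i$. Veronese embedding: let $M_1,\ldots,M_N$ be all the monomials of degree $k$ in $K[t_1,\ldots,t_s]$, $N=\binom{k+s-1}{s-1}$. Then $\rho_k\colon\mathbb{P}^{s-1}\to\mathbb{P}^{N-1}$ is the map $[x]\mapsto[(M_1(x),\ldots,M_N(x))]$. *)

(* Defs.v *)
From HB Require Import structures.
From mathcomp Require Import all_boot all_order all_algebra.
From mathcomp Require Import generic_quotient.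
From mathcomp Require Import mpoly.

Set Implicit Arguments.
Unset Strict Implicit.
Unset Printing Implicit Defensive.

Import GRing.Theory.
Local Open Scope ring_scope.
Local Open Scope quotient_scope.

(* Vector spaces over a finite field have finitely many subspaces; this is    *)
(* what makes the minimum in [ghw] a finite one.                              *)
Section FiniteVspace.
Import VectorInternalTheory.
HB.instance Definition _ (K : finFieldType) (vT : vectType K) :=
  [Countable of {vspace vT} by <:].
HB.instance Definition _ (K : finFieldType) (vT : vectType K) :=
  [Finite of {vspace vT} by <:].
End FiniteVspace.

Section Codes.
Variables (K : finFieldType) (m : nat).
Implicit Types C D : {vspace 'rV[K]_m}.

Definition code_length C : nat := m.

Definition supp D : {set 'I_m} :=
  [set i | [exists a : 'rV[K]_m, (a \in D) && (a 0 i != 0)]].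

(* The default value m of the minimum is an upper bound of all supports, so   *)
(* it is irrelevant as soon as r <= \dim C, see [ghwP].                       *)
Definition ghw C (r : nat) : nat :=
  \big[minn/m]_(D : {vspace 'rV[K]_m} | (D <= C)%VS && (\dim D == r)) #|supp D|.

Definition min_distance C : nat := ghw C 1.

Lemma ghw_le C D r : (D <= C)%VS -> \dim D = r -> (ghw C r <= #|supp D|)%N.
Proof.
move=> sDC dD; rewrite /ghw; move: (mem_index_enum D).
elim: (index_enum _) => // E s IHs; rewrite in_cons big_cons.
case/predU1P=> [<-|/IHs le_s]; first by rewrite sDC dD eqxx geq_minl.
by case: ifP => // _; rewrite geq_min le_s orbT.
Qed.

Lemma ghwP C r : (r <= \dim C)%N ->
  exists D, [/\ (D <= C)%VS, \dim D = r & #|supp D| = ghw C r].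
Proof.
move=> rC.
have [D0 /andP[sD0 /eqP dD0]] :
    exists D, (D <= C)%VS && (\dim D == r).
  exists <<take r (vbasis C)>>%VS; apply/andP; split.
    by apply/span_subvP=> v /mem_take; apply: vbasis_mem.
  have fr : free (take r (vbasis C)).
    by apply: (@catl_free _ _ (drop r (vbasis C))); rewrite cat_take_drop
      (basis_free (vbasisP C)).
  by move: fr; rewrite /free => /eqP ->; rewrite size_takel ?size_tuple.
have leF D : (#|supp D| <= m)%N.
  by rewrite -[X in (_ <= X)%N](card_ord m); exact: max_card.
case: (@arg_minnP _ D0 (fun D => (D <= C)%VS && (\dim D == r))
  (fun D => #|supp D|)); first by rewrite sD0 dD0 eqxx.
move=> D /andP[sD /eqP dD] minD; exists D; split => //.
apply/eqP; rewrite eqn_leq ghw_le // andbT /ghw.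
elim/big_ind: _ => [|x y hx hy|E /minD //]; first exact: leF.
by rewrite leq_min hx hy.
Qed.

End Codes.

Section ProjectiveSpace.
Variables (K : finFieldType) (n : nat).

Definition nzvec := {x : 'rV[K]_n.+1 | x != 0}.

Definition scale_rel : rel nzvec :=
  fun x y => [exists c : K, (c != 0) && (val y == c *: val x)].

Lemma scale_relP x y :
  reflect (exists2 c : K, c != 0 & val y = c *: val x) (scale_rel x y).
Proof.
apply: (iffP existsP) => [[c /andP[c0 /eqP e]]|[c c0 e]]; exists c => //.
by rewrite c0 e eqxx.
Qed.

Lemma scale_rel_refl : reflexive scale_rel.
Proof. by move=> x; apply/scale_relP; exists 1; rewrite ?oner_neq0 ?scale1r. Qed.

Lemma scale_rel_sym : ssrbool.symmetric scale_rel.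
Proof.
have aux x y : scale_rel x y -> scale_rel y x.
  case/scale_relP=> c c0 e; apply/scale_relP; exists c^-1; first by rewrite invr_eq0.
  by rewrite e scalerA mulVf // scale1r.
by move=> x y; apply/idP/idP; apply: aux.
Qed.

Lemma scale_rel_trans : transitive scale_rel.
Proof.
move=> y x z /scale_relP[c c0 e] /scale_relP[c' c0' e'].
apply/scale_relP; exists (c' * c); first by rewrite mulf_neq0.
by rewrite e' e scalerA.
Qed.

Canonical scale_equiv :=
  EquivRel scale_rel scale_rel_refl scale_rel_sym scale_rel_trans.

(* [proj K n] is the projective space P^n, i.e. P^(s-1) for s = n.+1.         *)
Definition proj := {eq_quot scale_rel}.
HB.instance Definition _ := Quotient.on proj.
HB.instance Definition _ := EqQuotient.on proj.
HB.instance Definition _ := Choice.on proj.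
HB.instance Definition _ := Countable.on proj.
HB.instance Definition _ :=
  isFinite.Build proj (pcan_enumP (can_pcan (@reprK _ proj))).

Definition pclass (x : nzvec) : proj := \pi_proj x.

Lemma pclassP x y :
  reflect (exists2 c : K, c != 0 & val y = c *: val x) (pclass x == pclass y).
Proof. by rewrite /pclass eqmodE; apply: scale_relP. Qed.

End ProjectiveSpace.

Definition peval (K : finFieldType) (n : nat) (x : nzvec K n)
    (h : {mpoly K[n.+1]}) : K :=
  h.@[fun i => val x 0 i].

Section ReedMuller.
Variables (K : finFieldType) (n : nat) (Y : {set proj K n}) (e : nat).

(* The choices made in the construction of C_Y(e): an enumeration of Y with   *)
(* representatives P_i (the P_i have distinct classes since there are #|Y| of *)
(* them), and forms h_i of degree e with h_i(P_i) != 0. [dhomog n.+1 K e] is  *)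
(* K[t_0,...,t_n]_e, zero included.                                           *)
Record rm_choice := RmChoice {
  rm_pt : 'I_#|Y| -> nzvec K n;
  rm_den : 'I_#|Y| -> dhomog n.+1 K e;
  rm_ptP : [set pclass (rm_pt i) | i : 'I_#|Y|] = Y;
  rm_denP : forall i, peval (rm_pt i) (rm_den i) != 0
}.

Variable c : rm_choice.

Definition rm_eval (h : dhomog n.+1 K e) : 'rV[K]_#|Y| :=
  \row_i (peval (rm_pt c i) h / peval (rm_pt c i) (rm_den c i)).

Lemma rm_eval_is_linear : linear rm_eval.
Proof.
move=> a f g; apply/rowP=> i; rewrite !mxE /peval mevalD mevalZ.
by rewrite mulrDl mulrA.
Qed.

HB.instance Definition _ :=
  GRing.isLinear.Build K (dhomog n.+1 K e) 'rV[K]_#|Y| _ rm_eval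
    rm_eval_is_linear.

Definition rm_code : {vspace 'rV[K]_#|Y|} := limg (linfun rm_eval).

Lemma rm_codeP a :
  reflect (exists h : dhomog n.+1 K e, a = rm_eval h) (a \in rm_code).
Proof.
apply: (iffP memv_imgP) => [[h _ ->]|[h ->]]; exists h; rewrite ?memvf //.
  by rewrite lfunE.
by rewrite lfunE.
Qed.

End ReedMuller.

Section RmChoiceExists.
Variables (K : finFieldType) (n : nat).

Lemma nzvec_coord (x : nzvec K n) : exists i, val x 0 i != 0.
Proof. by case: x => x /= /rV0Pn. Qed.

Lemma rm_choice_exists (Y : {set proj K n}) (e : nat) : inhabited (rm_choice Y e).
Proof.
pose P (i : 'I_#|Y|) : nzvec K n := repr (enum_val i).
pose j i : 'I_n.+1 := xchoose (nzvec_coord (P i)).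
have hom i : ('X_(j i) ^+ e : {mpoly K[n.+1]}) \is e.-homog.
  by rewrite mpolyXn dhomogX /= mdegMn mdeg1 mul1n.
exists; apply: (@RmChoice _ _ _ _ P (fun i => DHomog (hom i))).
  apply/setP=> y; apply/imsetP/idP => [[i _ ->]|yY].
    by rewrite /pclass reprK enum_valP.
  by exists (enum_rank_in yY y); rewrite // /pclass reprK enum_rankK_in.
move=> i; rewrite /peval /= rmorphXn /= mevalXU expf_neq0 //.
exact: (xchooseP (nzvec_coord (P i))).
Qed.

End RmChoiceExists.

Section Veronese.
Variables (K : finFieldType) (n k : nat).

(* N = 'C(k + s - 1, s - 1) with s = n.+1; it is positive.                    *)
Definition Nmon : nat := 'C(k + n, n).

(* M enumerates all monomials of degree k in n.+1 variables. The index type   *)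
(* is 'I_Nmon, in the form 'I_(Nmon.-1).+1 required by P^(Nmon - 1).          *)
Definition monomial_enum (M : 'I_Nmon.-1.+1 -> 'X_{1..n.+1}) : Prop :=
  injective M /\ forall t, mdeg t = k <-> exists i, M i = t.

Lemma Nmon_gt0 : (0 < Nmon)%N.
Proof. by rewrite /Nmon bin_gt0 leq_addl. Qed.

Lemma monomial_enum_exists : exists M, monomial_enum M.
Proof.
have [b [sz ub hb]] : exists b : seq 'X_{1..n.+1},
    [/\ size b = Nmon, uniq b & forall t, (mdeg t == k) = (t \in b)].
  exists [seq s2m t | t : k.-tuple 'I_n.+1 <- enum (mpoly.basis n.+1 k)].
  split; [|exact: uniq_basis|exact: basis_cover].
  by rewrite size_basis /Nmon -[in RHS]bin_sub ?leq_addl // addnK.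
rewrite /monomial_enum; move: Nmon_gt0 sz; case: Nmon => // N _ sz.
exists (fun i => nth 0%MM b i); split.
  by move=> i j /eqP; rewrite nth_uniq ?sz ?ltn_ord // => /eqP /val_inj.
move=> t; split.
  move=> dt; have tb : t \in b by rewrite -hb dt eqxx.
  have lt : (index t b < N.+1)%N by rewrite -sz index_mem.
  by exists (Ordinal lt); rewrite /= nth_index.
by case=> i <-; apply/eqP; rewrite hb mem_nth // sz ltn_ord.
Qed.

Variables (M : 'I_Nmon.-1.+1 -> 'X_{1..n.+1}) (hM : monomial_enum M).

Definition veronese_vec (x : nzvec K n) : 'rV[K]_Nmon.-1.+1 :=
  \row_i peval x 'X_[M i].

Lemma veronese_vec_neq0 x : veronese_vec x != 0.
Proof.
have [i xi] := nzvec_coord x.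
have dt : mdeg (U_(i) *+ k)%MM = k by rewrite mdegMn mdeg1 mul1n.
have [j Mj] := (hM.2 _).1 dt.
apply/rV0Pn; exists j; rewrite mxE Mj /peval -mpolyXn rmorphXn /= mevalXU.
by rewrite expf_neq0.
Qed.

Definition veronese_nz (x : nzvec K n) : nzvec K Nmon.-1 :=
  Sub (veronese_vec x) (veronese_vec_neq0 x).

Lemma val_veronese_nz x : val (veronese_nz x) = veronese_vec x.
Proof. by []. Qed.

Definition veronese (p : proj K n) : proj K Nmon.-1 :=
  pclass (veronese_nz (repr p)).

Lemma veronese_pclass x : veronese (pclass x) = pclass (veronese_nz x).
Proof.
rewrite /veronese; apply/eqP/pclassP.
have /eqP/pclassP[c c0 e] : pclass (repr (pclass x)) = pclass x.
  by rewrite /pclass reprK.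
exists (c ^+ k); first by rewrite expf_neq0.
rewrite !val_veronese_nz; apply/rowP=> i.
rewrite [LHS]mxE [RHS]mxE [in RHS]mxE /peval !mevalX.
have dM : mdeg (M i) = k by apply/(hM.2 _).2; exists i.
rewrite -[in c ^+ k]dM mdegE -prodrXr -big_split /=.
by apply: eq_bigr => j _; rewrite e mxE exprMn.
Qed.

End Veronese.

(* Main.v *)
Require Import Defs.
From HB Require Import structures.
From mathcomp Require Import all_boot all_order all_algebra.
From mathcomp Require Import mpoly.

(** The points of rho_k(X) correspond bijectively to those of X, and pulling
    forms of degree d back along rho_k gives exactly the forms of degree kd,
    because every monomial of degree kd is a product of d monomials of degree
    k.  Hence the two codes differ by a permutation of the coordinates followed
    by a nonzero rescaling of each of them, which preserves dimensions and
    supports of subspaces. *)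

Set Implicit Arguments.
Unset Strict Implicit.
Unset Printing Implicit Defensive.

Import GRing.Theory.

Local Open Scope ring_scope.

(** * Codes that differ by a permutation and a nonzero rescaling of coordinates *)

Section MonomialEquivalence.
Variables (K : finFieldType) (m1 m2 : nat) (s : 'I_m2 -> 'I_m1) (u : 'I_m2 -> K).

Definition monomial_map (a : 'rV[K]_m1) : 'rV[K]_m2 := \row_i (u i * a 0 (s i)).

Lemma monomial_map_is_linear : linear monomial_map.
Proof. by move=> c a b; apply/rowP=> i; rewrite !mxE mulrDr mulrCA. Qed.

HB.instance Definition _ :=
  GRing.isLinear.Build K 'rV[K]_m1 'rV[K]_m2 _ monomial_map
    monomial_map_is_linear.

Hypotheses (s_bij : bijective s) (u_neq0 : forall i, u i != 0).

Let phi := linfun monomial_map.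

Lemma monomial_map_lker0 : lker phi == 0%VS.
Proof.
have [t _ tK] := s_bij.
apply/lker0P=> a b; rewrite !lfunE => /rowP e; apply/rowP=> j.
by have := e (t j); rewrite !mxE tK => /(mulfI (u_neq0 _)).
Qed.

(** As [u i] is nonzero, coordinate [i] of [phi a] vanishes exactly when coordinate [s i] of [a]
    does; the support is therefore pulled back along the bijection [s]. *)
Lemma card_supp_monomial_map (D : {vspace 'rV[K]_m1}) :
  #|supp (phi @: D)| = #|supp D|.
Proof.
have -> : supp (phi @: D) = s @^-1: supp D.
  apply/setP=> i; rewrite !inE; apply/existsP/existsP.
    case=> _ /andP[/memv_imgP[a aD ->]]; rewrite lfunE mxE mulf_eq0 negb_or.
    by case/andP=> _ ai; exists a; rewrite aD.
  case=> a /andP[aD ai]; exists (phi a); rewrite memv_img //= lfunE mxE.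
  by rewrite mulf_neq0.
exact/on_card_preimset/onW_bij.
Qed.

Lemma dim_monomial_map (D : {vspace 'rV[K]_m1}) : \dim (phi @: D) = \dim D.
Proof. by rewrite limg_dim_eq // (eqP monomial_map_lker0) capv0. Qed.

Lemma ghw_monomial_map (C : {vspace 'rV[K]_m1}) r :
  (r <= \dim C)%N -> ghw (phi @: C)%VS r = ghw C r.
Proof.
move=> rC; apply/eqP; rewrite eqn_leq; apply/andP; split.
  have [D [sDC dD <-]] := ghwP rC; rewrite -card_supp_monomial_map.
  by apply: ghw_le; rewrite ?limgS ?dim_monomial_map.
have rC' : (r <= \dim (phi @: C))%N by rewrite dim_monomial_map.
have [D [sDC dD <-]] := ghwP rC'.
(* An optimal subspace of the image code is the image of its preimage, so it can be carried back to
   [C] with the same dimension and support size. *)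
have eD : (phi @: (phi @^-1: D))%VS = D.
  by apply: lpreimK; apply: subv_trans sDC _; apply: limgS; apply: subvf.
rewrite -{}eD in sDC dD *; rewrite card_supp_monomial_map.
apply: ghw_le; last by rewrite -dim_monomial_map.
by move: sDC; rewrite limg_ker0 // monomial_map_lker0.
Qed.

End MonomialEquivalence.

(** * Factoring monomials of degree [k * d] into monomials of degree [k] *)

Section MonomialFactors.
Variable n : nat.
Implicit Type t : 'X_{1..n}.

(** Induction on [a], moving one variable that occurs in [t] into the first factor. *)
Lemma multinom_split t a b : mdeg t = (a + b)%N ->
  exists t1 t2, [/\ t = (t1 + t2)%MM, mdeg t1 = a & mdeg t2 = b].
Proof.
elim: a b t => [|a IHa] b t dt.
  by exists 0%MM, t; rewrite add0m mdeg0.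
have [i ti] : exists i, t i != 0%N.
  apply/existsP; apply: contra_eqT dt => /existsPn t0.
  suff -> : t = 0%MM by rewrite mdeg0.
  by apply/mnmP=> i; rewrite mnmE; apply/eqP; rewrite -[_ == _]negbK t0.
have et : (t - U_(i) + U_(i))%MM = t by rewrite submK // lep1mP.
have /IHa[t1 [t2 [e d1 d2]]] : mdeg (t - U_(i))%MM = (a + b)%N.
  by move: dt; rewrite -{1}et mdegD mdeg1 addn1 addSn => -[].
exists (U_(i) + t1)%MM, t2; split=> //; last by rewrite mdegD mdeg1 d1.
by rewrite -et e addmC addmA.
Qed.

Lemma mulmDn t a b : (t *+ (a + b) = t *+ a + t *+ b)%MM.
Proof. by apply/mnmP=> i; rewrite mnmDE !mulmnE mulnDr. Qed.

Variables (N k : nat) (M : 'I_N -> 'X_{1..n}).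

(** Exponent of what ['X_[w]] becomes when ['X_[M i]] is substituted for its [i]-th variable. *)
Definition mnm_pullback (w : 'X_{1..N}) : 'X_{1..n} :=
  (\sum_(i < N) M i *+ w i)%MM.

Lemma mdeg_mnm_pullback w :
  (forall i, mdeg (M i) = k) -> mdeg (mnm_pullback w) = (k * mdeg w)%N.
Proof.
move=> dM; rewrite mdeg_sum mdegE big_distrr /=.
by apply: eq_bigr => i _; rewrite mdegMn dM.
Qed.

(** Induction on [d]: split off a factor of degree [k], which is some [M i], and add [U_(i)] to the
    exponent found for the rest. *)
Lemma mnm_pullback_surj d t :
    (forall t1, mdeg t1 = k -> exists i, M i = t1) -> mdeg t = (k * d)%N ->
  exists2 w, mdeg w = d & mnm_pullback w = t.
Proof.
move=> surjM; elim: d t => [|d IHd] t dt.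
  exists 0%MM; first exact: mdeg0.
  rewrite /mnm_pullback big1 => [|i _]; last by rewrite mnmE mulm0n.
  by apply/esym/eqP; rewrite -mdeg_eq0 dt muln0.
rewrite mulnS in dt; have [t1 [t2 [-> d1 /IHd[w dw <-]]]] := multinom_split dt.
have [i <-] := surjM _ d1.
exists (U_(i) + w)%MM; first by rewrite mdegD mdeg1 dw.
rewrite /mnm_pullback; under eq_bigr => j _ do rewrite mnmDE mulmDn.
rewrite big_split /=; congr (_ + _)%MM.
rewrite (bigD1 i) //= big1 => [|j ji]; rewrite mnm1E ?eqxx ?addm0 //.
by rewrite eq_sym (negPf ji).
Qed.

End MonomialFactors.

Lemma dhomog_ind (R : comNzRingType) n d (P : {mpoly R[n]} -> Prop) :
    P 0 -> (forall p q, P p -> P q -> P (p + q)) ->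
    (forall c t, mdeg t = d -> P (c *: 'X_[t])) ->
  forall p, p \is d.-homog -> P p.
Proof.
move=> P0 PD PX p /dhomogP hp; rewrite [p]mpolyE big_seq.
by apply: big_ind => // t /hp; apply: PX.
Qed.

(** Needed because a chosen representative of a Veronese point is only a scalar multiple of the
    Veronese vector. *)
Lemma peval_homogZ (K : finFieldType) n d c (x y : nzvec K n)
    (h : {mpoly K[n.+1]}) :
  h \is d.-homog -> val y = c *: val x -> peval y h = c ^+ d * peval x h.
Proof.
move=> hh e; move: h hh; apply: dhomog_ind => [|p q hp hq|a t dt].
- by rewrite /peval !meval0 mulr0.
- by rewrite /peval !mevalD mulrDr -hp -hq.
rewrite /peval !mevalZ mulrCA; congr (_ * _).
rewrite !mevalX -dt mdegE -prodrXr -big_split /=.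
by apply: eq_bigr => j _; rewrite e mxE exprMn.
Qed.

(** * Pulling forms back along the Veronese map, and its injectivity *)

Section VeroneseCode.
Variables (K : finFieldType) (n k : nat).
Variables (M : 'I_(Nmon n k).-1.+1 -> 'X_{1..n.+1}) (hM : monomial_enum M).

Lemma peval_veronese_mnm (x : nzvec K n) w :
  peval (veronese_nz hM x) 'X_[w] = peval x 'X_[mnm_pullback M w].
Proof.
rewrite /peval mevalX -mprodXnE rmorph_prod /=.
by apply: eq_bigr => i _; rewrite mxE rmorphXn.
Qed.

Lemma veronese_pullback d (h : {mpoly K[(Nmon n k).-1.+1]}) :
    h \is d.-homog ->
  exists2 g : {mpoly K[n.+1]}, g \is (k * d).-homog
    & forall x, peval (veronese_nz hM x) h = peval x g.
Proof.
move: h; apply: dhomog_ind => [|p q [f hf ef] [g hg eg]|c w dw].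
- by exists 0 => [|x]; rewrite ?dhomog0 // /peval !meval0.
- exists (f + g) => [|x]; first exact: rpredD.
  by rewrite /peval !mevalD; congr (_ + _); [apply: ef|apply: eg].
exists (c *: 'X_[mnm_pullback M w]) => [|x].
  rewrite rpredZ // dhomogX /= (@mdeg_mnm_pullback _ _ k) ?dw // => i.
  by apply/hM.2; exists i.
by rewrite /peval !mevalZ; congr (_ * _); apply: peval_veronese_mnm.
Qed.

Lemma veronese_pullback_surj d (g : {mpoly K[n.+1]}) :
    g \is (k * d).-homog ->
  exists2 h : {mpoly K[(Nmon n k).-1.+1]}, h \is d.-homog
    & forall x, peval (veronese_nz hM x) h = peval x g.
Proof.
move: g; apply: dhomog_ind => [|p q [f hf ef] [g hg eg]|c t dt].
- by exists 0 => [|x]; rewrite ?dhomog0 // /peval !meval0.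
- exists (f + g) => [|x]; first exact: rpredD.
  by rewrite /peval !mevalD; congr (_ + _); [apply: ef|apply: eg].
have surjM t1 : mdeg t1 = k -> exists i, M i = t1 by move/hM.2.
have [w dw <-] := mnm_pullback_surj surjM dt.
exists (c *: 'X_[w]) => [|x]; first by rewrite rpredZ // dhomogX /= dw.
by rewrite /peval !mevalZ; congr (_ * _); apply: peval_veronese_mnm.
Qed.

(* If x_i != 0, the coordinates x_i^(k-1) x_j of the Veronese vector determine
   x up to the scalar x_i^(k-1). *)
Lemma veronese_inj : (0 < k)%N -> injective (@veronese K n k M hM).
Proof.
move=> k_gt0 p q; rewrite -[p]reprK -[q]reprK -/(pclass _) -/(pclass _).
move: (repr p) (repr q) => x y {p q}.
rewrite !veronese_pclass => /eqP/pclassP[c c0 e].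
have [i xi] := nzvec_coord x; apply/eqP/pclassP.
have coordE (z : nzvec K n) j :
    peval z 'X_[U_(i) *+ k.-1 + U_(j)] = val z 0 i ^+ k.-1 * val z 0 j.
  by rewrite /peval mpolyXD mevalM -mpolyXn rmorphXn /= !mevalXU.
have eqc j : val y 0 i ^+ k.-1 * val y 0 j
           = c * (val x 0 i ^+ k.-1 * val x 0 j).
  have /hM.2[l Ml] : mdeg (U_(i) *+ k.-1 + U_(j))%MM = k.
    by rewrite mdegD mdegMn !mdeg1 mul1n addn1 prednK.
  by move/rowP: e => /(_ l); rewrite !mxE Ml !coordE.
(* Case [j = i] of [eqc], whose right side is nonzero by the choice of [i]. *)
have yi : val y 0 i ^+ k.-1 != 0.
  have : c * (val x 0 i ^+ k.-1 * val x 0 i) != 0.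
    by rewrite !mulf_neq0 ?expf_neq0.
  by rewrite -eqc mulf_eq0 negb_or => /andP[].
exists (c * val x 0 i ^+ k.-1 / val y 0 i ^+ k.-1).
  by rewrite mulf_neq0 ?invr_eq0 // mulf_neq0 ?expf_neq0.
apply/rowP=> j; rewrite mxE; apply: (mulfI yi).
by rewrite eqc mulrA [RHS]mulrA [in RHS]mulrCA divff // mulr1.
Qed.

End VeroneseCode.

(** * Points and nontriviality of a Reed--Muller-type code *)

Section ReedMullerFacts.
Variables (K : finFieldType) (n e : nat) (Y : {set proj K n}) (c : rm_choice Y e).

(** By counting: [#|Y|] indices have an image of size [#|Y|]. *)
Lemma rm_pt_inj : injective (fun i => pclass (rm_pt c i)).
Proof.
have /imset_injP inj :
    #|[set pclass (rm_pt c i) | i in 'I_#|Y| ]| == #|{: 'I_#|Y| }|.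
  by rewrite (rm_ptP c) card_ord.
by move=> i j; apply: inj.
Qed.

Lemma rm_pt_mem i : pclass (rm_pt c i) \in Y.
Proof.
have : pclass (rm_pt c i) \in [set pclass (rm_pt c j) | j : 'I_#|Y|].
  exact: imset_f.
by rewrite (rm_ptP c).
Qed.

(** The form [rm_den c i] gives a codeword with entry 1 at [i]. This allows [r = 1] in
    [ghw_monomial_map], hence covers the minimum distance. *)
Lemma dim_rm_code_gt0 : Y != set0 -> (0 < \dim (rm_code c))%N.
Proof.
rewrite -card_gt0 => Y_gt0; pose i := Ordinal Y_gt0.
rewrite lt0n dimv_eq0; apply: contraTneq isT => C0.
have : rm_eval c (rm_den c i) \in rm_code c by apply/rm_codeP; eexists.
rewrite C0 memv0 => /eqP/rowP/(_ i)/eqP.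
by rewrite !mxE divff ?rm_denP // oner_eq0.
Qed.

End ReedMullerFacts.

Lemma rm_code_veronese (K : finFieldType) (n k d : nat) (X : {set proj K n})
    (M : 'I_(Nmon n k).-1.+1 -> 'X_{1..n.+1}) (hM : monomial_enum M)
    (cX : rm_choice X (k * d)%N)
    (cVX : rm_choice [set veronese hM p | p in X] d) :
  (0 < k)%N ->
  exists s u, [/\ bijective s, forall i, u i != 0
    & rm_code cVX = (linfun (monomial_map s u) @: rm_code cX)%VS].
Proof.
move=> k_gt0.
have ptE i : exists jc : 'I_#|X| * K, (jc.2 != 0) &&
    (val (rm_pt cVX i) == jc.2 *: val (veronese_nz hM (rm_pt cX jc.1))).
  have /imsetP[p] := rm_pt_mem cVX i.
  rewrite -{1}(rm_ptP cX) => /imsetP[j _ ->].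
  rewrite veronese_pclass => /esym/eqP/pclassP[c c0 e].
  by exists (j, c); rewrite c0 e eqxx.
pose s i := (xchoose (ptE i)).1; pose c i := (xchoose (ptE i)).2.
have c0 i : c i != 0 by have /andP[] := xchooseP (ptE i).
have ptsE i : val (rm_pt cVX i) = c i *: val (veronese_nz hM (rm_pt cX (s i))).
  by have /andP[_ /eqP] := xchooseP (ptE i).
(* Indices with equal [s] have the same class, hence coincide; the cardinalities agree since
   [veronese] is injective. *)
have s_bij : bijective s.
  apply: inj_card_bij; last by rewrite !card_ord card_imset //; apply: veronese_inj.
  have clE i : pclass (rm_pt cVX i) = pclass (veronese_nz hM (rm_pt cX (s i))).
    by apply/esym/eqP/pclassP; exists (c i).
  by move=> i j eqs; apply: (@rm_pt_inj _ _ _ _ cVX); rewrite /= !clE eqs.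
(* The power of [c i] accounts for the change of representative in degree [d]; the quotient replaces
   the denominator chosen in [cX] by that of [cVX]. *)
pose u i := c i ^+ d * peval (rm_pt cX (s i)) (rm_den cX (s i))
            / peval (rm_pt cVX i) (rm_den cVX i).
have evalE (h : dhomog _ K d) (g : dhomog _ K (k * d)) :
    (forall x, peval (veronese_nz hM x) h = peval x g) ->
  rm_eval cVX h = linfun (monomial_map s u) (rm_eval cX g).
  move=> hg; rewrite lfunE; apply/rowP=> i; rewrite !mxE.
  rewrite (peval_homogZ (valP h) (ptsE i)) hg /u.
  rewrite [RHS]mulrAC; congr (_ / _); rewrite -mulrA; congr (_ * _).
  by rewrite mulrCA divff ?mulr1 ?rm_denP.
exists s, u; split=> // [i|].
  by rewrite !mulf_neq0 ?invr_eq0 ?expf_neq0 ?rm_denP.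
(* One inclusion pulls forms back to [X], the other lifts forms of degree [k * d]. *)
apply/eqP; rewrite eqEsubv; apply/andP; split; apply/subvP => a.
  case/rm_codeP=> h ->; have [g hg /(evalE h (DHomog hg)) ->] :=
    veronese_pullback hM (valP h).
  by apply/memv_img/rm_codeP; eexists.
case/memv_imgP=> _ /rm_codeP[g ->] ->.
have [h hh /(evalE (DHomog hh) g) <-] := veronese_pullback_surj hM (valP g).
by apply/rm_codeP; eexists.
Qed.

Theorem theorem3p2 (K : finFieldType) (n k d : nat) (X : {set proj K n})
    (hX : X != set0) (hk : (1 <= k)%N) (hd : (1 <= d)%N)
    (M : 'I_(Nmon n k).-1.+1 -> 'X_{1..n.+1}) (hM : monomial_enum M)
    (cX : rm_choice X (k * d)%N)
    (cVX : rm_choice [set veronese hM p | p in X] d) :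
  [/\ code_length (rm_code cVX) = code_length (rm_code cX),
      \dim (rm_code cVX) = \dim (rm_code cX),
      min_distance (rm_code cVX) = min_distance (rm_code cX) &
      forall r : nat, (1 <= r <= \dim (rm_code cX))%N ->
        ghw (rm_code cVX) r = ghw (rm_code cX) r].
Proof.
have [s [u [s_bij u_neq0 ->]]] := rm_code_veronese cX cVX hk.
split.
- by rewrite /code_length card_imset //; apply: veronese_inj.
- by rewrite dim_monomial_map.
- by rewrite /min_distance ghw_monomial_map // dim_rm_code_gt0.
by move=> r /andP[_ rC]; rewrite ghw_monomial_map.
Qed.
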